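(* Let $\ell$, $m$, and $p$ be positive integers such that $\ell\ge m>p$, and let $n_1\ge n_2\ge n_3\ge \ell$ be integers. Then every graph obtained by the construction $\mathcal{C}_3(\ell,m;n_1,n_2,n_3)$ described in the context is a $K_{\ell,m,p}$-saturated subgraph of $K_{n_1,n_2,n_3}$. Thus, $$\operatorname{sat}(K_{n_1,n_2,n_3},K_{\ell,m,p})\le 2(m-1)(n_1+n_2+n_3)+(\ell-m)(n_2+2n_3)-3\ell(m-1)+3m-3.$$
   Context: All graphs are simple, and $[k]=\{1,\dots,k\}$. For graphs $F$ and $H$, a subgraph $G$ of $H$ (with $V(G)=V(H)$) is an $F$-saturated subgraph of $H$ if $G$ contains no copy of $F$ as a (not necessarily induced) subgraph, but $G+e$ contains a copy of $F$ for every $e\in E(H)\setminus E(G)$. The number $\operatorname{sat}(H,F)$ is the minimum number of edges in an $F$-saturated subgraph of $H$. The host graph $K_{n_1,n_2,n_3}$ is the complete tripartite graph with partite sets $V_1,V_2,V_3$, $|V_i|=n_i$. The graph $K_{a,b,c}$ is the complete tripartite graph with part sizes $a,b,c$. Arithmetic in subscripts is modulo 3 (with values in $[3]$). Construction $\mathcal{C}_3(\ell,m;n_1,n_2,n_3)$: For each $i\in[3]$ let $S_i$ be an $(m-1)$-vertex subset of $V_i$, and join every vertex of $S_i$ to all vertices of $V_{i+1}\cup V_{i+2}$. For all $i<j$ in $[3]$, join $V_i\setminus S_i$ to $V_j\setminus S_j$ by a bipartite graph with exactly $(\ell-m)(n_j-m+1)$ edges and maximum degree at most $\ell-m$; thus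 each vertex in $V_j\setminus S_j$ has exactly $\ell-m$ neighbors in $V_i\setminus S_i$, and each vertex in $V_i\setminus S_i$ has at most $\ell-m$ neighbors in $V_j\setminus S_j$. There are no other edges. *)

(* Defs.v *)
(* A graph on a vertex type T is given by its edge set, a set
   of two-element subsets of T; every graph below is a subgraph of a complete
   tripartite graph, so no separate simplicity hypothesis is needed. *)
From mathcomp Require Import all_boot.

Set Implicit Arguments.
Unset Strict Implicit.
Unset Printing Implicit Defensive.

Section Graphs.

Variable T : finType.
Implicit Types (G H : {set {set T}}) (A B : {set T}).

Definition cross A B : {set {set T}} := [set [set x; y] | x in A, y in B].

Definition degree G (v : T) : nat := #|[set e in G | v \in e]|.

Definition max_degree G : nat := \max_(v : T) degree G v.

(* The edges of F are sent to edges of G by an injection of the vertices;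
   the vertex set of F is all of U, isolated vertices included. *)
Definition has_copy (U : finType) (F : {set {set U}}) G : bool :=
  [exists f : {ffun U -> T}, injectiveb f && [forall e in F, f @: e \in G]].

Definition saturated (U : finType) (H : {set {set T}}) (F : {set {set U}}) G :
    bool :=
  [&& G \subset H, ~~ has_copy F G
    & [forall e in H :\: G, has_copy F (e |: G)]].

(* The default value #|H| is an upper bound on the size of every subgraph of
   H; as soon as F has an edge, a saturated subgraph exists (sat_attained) and
   sat H F is a genuine minimum. *)
Definition sat (U : finType) (H : {set {set T}}) (F : {set {set U}}) : nat :=
  \big[minn/#|H|]_(G : {set {set T}} | saturated H F G) #|G|.

Lemma sat_le (U : finType) H (F : {set {set U}}) G :
  saturated H F G -> sat H F <= #|G|.
Proof.
move=> satG; rewrite /sat; have := mem_index_enum G.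
elim: (index_enum _) => // K s IHs; rewrite inE big_cons.
case/predU1P=> [<-|/IHs les]; first by rewrite satG geq_minl.
by case: ifP => // _; rewrite geq_min les orbT.
Qed.

Lemma saturated_exists (U : finType) H (F : {set {set U}}) :
  F != set0 -> exists G, saturated H F G.
Proof.
case/set0Pn=> e0 Fe0; pose P G := (G \subset H) && ~~ has_copy F G.
have P0 : P set0.
  rewrite /P sub0set /=; apply/existsP => -[f /andP[_ /forall_inP/(_ _ Fe0)]].
  by rewrite inE.
have [G /maxsetP[/andP[sGH nG] maxG] _] := maxset_exists P0.
exists G; rewrite /saturated sGH nG /=; apply/forall_inP => e /setDP[He nGe].
apply: contraR nGe => nGe; rewrite -[G](maxG (e |: G)) ?setU11 ?subsetUr //.
by rewrite /P nGe andbT subUset sub1set He.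
Qed.

Lemma sat_attained (U : finType) H (F : {set {set U}}) :
  F != set0 -> exists2 G, saturated H F G & sat H F = #|G|.
Proof.
move=> /(saturated_exists H)[G0 satG0].
have [G satG minG] := arg_minnP (fun G : {set {set T}} => #|G|) satG0.
exists G => //; apply/eqP; rewrite eqn_leq sat_le //=.
rewrite /sat; elim/big_ind: _ => [|x y Gx Gy|K /minG //].
  by case/and3P: satG => sGH _ _; apply: subset_leq_card.
by rewrite leq_min Gx.
Qed.

End Graphs.

(* The part V_1, V_2, V_3 of sizes a, b, c has index 0, 1, 2 : 'I_3. *)
Definition part_size (a b c : nat) (i : 'I_3) : nat := nth 0 [:: a; b; c] i.

Definition tri_vertex (a b c : nat) : finType :=
  {i : 'I_3 & 'I_(part_size a b c i)}.

Definition part (a b c : nat) (i : 'I_3) : {set tri_vertex a b c} :=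
  [set v | tag v == i].

Definition complete_tripartite (a b c : nat) : {set {set tri_vertex a b c}} :=
  \bigcup_(ij : 'I_3 * 'I_3 | ij.1 < ij.2)
     cross (part a b c ij.1) (part a b c ij.2).

(* ordS is the successor modulo 3. The subtractions below are exact under
   0 < m <= l and m <= part_size n1 n2 n3 j. *)
Definition C3 (l m n1 n2 n3 : nat) (G : {set {set tri_vertex n1 n2 n3}}) :
    Prop :=
  let V := part n1 n2 n3 in
  G \subset complete_tripartite n1 n2 n3 /\
  exists S : 'I_3 -> {set tri_vertex n1 n2 n3},
    [/\ forall i, S i \subset V i /\ #|S i| = m - 1,
        forall i, cross (S i) (V (ordS i) :|: V (ordS (ordS i))) \subset G
      & forall i j : 'I_3, i < j ->
          let B := G :&: cross (V i :\: S i) (V j :\: S j) in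
          #|B| = (l - m) * (part_size n1 n2 n3 j - m + 1) /\
          max_degree B <= l - m].

(* Main.v *)
Require Import Defs.
From mathcomp Require Import all_boot all_order all_algebra.
From mathcomp Require Import zify.

Set Implicit Arguments.
Unset Strict Implicit.
Unset Printing Implicit Defensive.

(** Why the theorem is true.  Write R_i for V_i minus S_i, and d for l - m.

    No copy.  The vertices of a copy of K_{l,m,p} that lie in one part V_i are
    pairwise nonadjacent, hence lie in one part of the copy; three parts on
    each side make this a bijection, so each part of the copy sits inside a
    single V_i.  The part of size m has a vertex y outside S_j, since
    |S_j| = m - 1; the part of size l has at least l - (m - 1) = d + 1 vertices
    in R_i.  They are all neighbours of y, but y has at most d neighbours in
    R_i (tripartite_free).

    Saturation.  A missing edge xy joins R_i to R_j, with i < j say.  The edge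
    count and the degree bound together force y to have exactly d neighbours in
    R_i (bipartite_degree_eq), so S_i, these neighbours and x make l vertices,
    S_j and y make m vertices, and S_k for the third index k has room for p
    more.  With xy added they span K_{l,m,p} (tripartite_saturating).

    Upper bound.  Between V_i and V_j every pair outside R_i x R_j is an edge,
    and R_i x R_j carries d |R_j| edges; summing over the three pairs gives the
    claimed expression (construction_card).  The bound on sat then needs one
    graph of the construction to exist: between R_i and R_j take a circulant
    graph, where x is adjacent to y when x - y modulo |R_i| is one of the d
    residues 0, ..., d - 1 (circulant_C3). *)

(** * Edges between two disjoint sets *)

Section Bipartite.
Variable T : finType.
Implicit Types (G : {set {set T}}) (A B : {set T}).

Definition nbrs G (v : T) A : {set T} := [set x in A | [set x; v] \in G].

Lemma in_nbrs G v A x : (x \in nbrs G v A) = (x \in A) && ([set x; v] \in G).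
Proof. by rewrite inE. Qed.

Lemma crossP A B e :
  reflect (exists x y, [/\ x \in A, y \in B & e = [set x; y]]) (e \in cross A B).
Proof.
apply: (iffP imset2P) => [[x y Ax By ->]|[x [y [Ax By ->]]]]; last by exists x y.
by exists x, y.
Qed.

Lemma cross_sym A B : cross A B = cross B A.
Proof.
by apply/setP=> e; apply/crossP/crossP=> -[x [y [? ? ->]]]; exists y, x; rewrite setUC.
Qed.

Lemma crossS A A' B B' :
  A \subset A' -> B \subset B' -> cross A B \subset cross A' B'.
Proof. by move=> sA sB; apply: imset2S. Qed.

Lemma in_cross A B x y : x \in A -> y \in B -> [set x; y] \in cross A B.
Proof. by move=> Ax By; apply/crossP; exists x, y. Qed.

Lemma set2_disjoint_inj A B x y x' y' : [disjoint A & B] ->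
    x \in A -> y \in B -> x' \in A -> y' \in B ->
  [set x; y] = [set x'; y'] -> x = x' /\ y = y'.
Proof.
move=> /disjointFr dAB Ax By Ax' By' eqe; split; apply/eqP.
  have: x \in [set x'; y'] by rewrite -eqe set21.
  by rewrite !inE => /orP[//|/eqP ex]; rewrite -ex (dAB x Ax) in By'.
have: y \in [set x'; y'] by rewrite -eqe set22.
by rewrite !inE => /orP[/eqP ey|//]; rewrite ey (dAB x' Ax') in By.
Qed.

(** Double counting: as A and B are disjoint, an edge between them determines
    its end in B. *)
Lemma card_bipartite G A B : [disjoint A & B] ->
  #|G :&: cross A B| = \sum_(y in B) #|nbrs G y A|.
Proof.
move=> dAB; pose h (z : T * T) : {set T} := [set z.1; z.2].
pose P := [set z | (z.1 \in A) && (z.2 \in B) && (h z \in G)].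
have -> : G :&: cross A B = h @: P.
  apply/setP=> e; rewrite inE; apply/andP/imsetP => [[Ge /crossP[x [y [Ax By De]]]]|].
    by exists (x, y); rewrite ?inE /= ?Ax ?By // /h /= -De.
  by case=> -[x y]; rewrite inE /= => /andP[/andP[Ax By] Gh] ->; split; rewrite ?in_cross.
rewrite card_in_imset; last first.
  move=> [x y] [x' y']; rewrite !inE /= => /andP[/andP[Ax By] _] /andP[/andP[Ax' By'] _].
  by case/(set2_disjoint_inj dAB Ax By Ax' By') => -> ->.
rewrite -sum1_card.
under [RHS]eq_bigr => y _ do rewrite -sum1_card.
rewrite (exchange_big_dep (mem A)) /=; last by move=> y x _; rewrite inE => /andP[].
rewrite pair_big_dep /=; apply: eq_bigl => -[x y]; rewrite !inE /h /= -andbA.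
by case: (x \in A).
Qed.

Lemma card_cross A B : [disjoint A & B] -> #|cross A B| = #|A| * #|B|.
Proof.
move=> dAB; rewrite -(setTI (cross A B)) card_bipartite // mulnC -sum_nat_const.
by apply: eq_bigr => y _; congr #|pred_of_set _|; apply/setP=> x; rewrite !inE andbT.
Qed.

Lemma degree_bipartite G A B y : [disjoint A & B] -> y \in B ->
  degree (G :&: cross A B) y = #|nbrs G y A|.
Proof.
move=> dAB By; rewrite /degree -(card_in_imset (f := fun x => [set x; y])).
  congr #|pred_of_set _|; apply/setP=> e; rewrite !inE; apply/andP/imsetP.
    case=> /andP[Ge /crossP[x [z [Ax Bz De]]]]; rewrite De !inE.
    case/orP=> /eqP eyz; first by rewrite eyz (disjointFr dAB Ax) in By.
    by exists x; rewrite ?inE ?Ax ?eyz // -De.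
  by case=> x; rewrite inE => /andP[Ax Gx] ->; rewrite Gx set22 in_cross.
move=> x x'; rewrite !inE => /andP[Ax _] /andP[Ax' _].
by case/(set2_disjoint_inj dAB Ax By Ax' By).
Qed.

Lemma max_degreeP G d :
  reflect (forall v, degree G v <= d) (max_degree G <= d).
Proof. by apply: (iffP (bigmax_leqP _ _ _)) => h v; auto. Qed.

Lemma max_degree_bipartite G A B d : [disjoint A & B] ->
    (forall y, y \in B -> #|nbrs G y A| <= d) ->
    (forall x, x \in A -> #|nbrs G x B| <= d) ->
  max_degree (G :&: cross A B) <= d.
Proof.
move=> dAB dB dA; apply/max_degreeP => v.
have [Bv|nBv] := boolP (v \in B); first by rewrite degree_bipartite ?dB.
have [Av|nAv] := boolP (v \in A).
  by rewrite cross_sym degree_bipartite ?dA // disjoint_sym.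
rewrite /degree (_ : [set e in _ | _] = set0) ?cards0 //; apply/setP=> e.
rewrite !inE; apply/andP => -[/andP[_ /crossP[x [y [Ax By ->]]]]].
by rewrite !inE => /orP[]/eqP ev; [rewrite ev Ax in nAv | rewrite ev By in nBv].
Qed.

(** d |B| edges are spread over |B| vertices of degree at most d, so no degree
    can fall short of d.  The construction only asks for a number of edges and a
    degree bound; this recovers its exact degrees. *)
Lemma bipartite_degree_eq G A B d : [disjoint A & B] ->
    max_degree (G :&: cross A B) <= d -> #|G :&: cross A B| = d * #|B| ->
  forall y, y \in B -> #|nbrs G y A| = d.
Proof.
move=> dAB /max_degreeP dG; rewrite card_bipartite // => sumE.
have le y : y \in B -> #|nbrs G y A| <= d ?= iff (#|nbrs G y A| == d).
  by move=> By; split=> //; rewrite -(degree_bipartite G dAB By).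
have [_] := leqif_sum le; rewrite sum_nat_const mulnC sumE eqxx => /esym/forall_inP h.
by move=> y /h/eqP.
Qed.
End Bipartite.

(** * Complete tripartite graphs and their copies *)

Section TripartiteVertices.
Variables a b c : nat.
Local Notation V := (part a b c).
Local Notation N := (part_size a b c).

Lemma in_part i (v : tri_vertex a b c) : (v \in V i) = (tag v == i).
Proof. by rewrite inE. Qed.

Lemma part_disjoint i j : i != j -> [disjoint V i & V j].
Proof.
move=> nij; rewrite -setI_eq0; apply/eqP/setP=> v; rewrite !inE.
by apply/andP=> -[/eqP-> /eqP eij]; rewrite eij eqxx in nij.
Qed.

Definition vertex i (k : 'I_(N i)) : tri_vertex a b c := Tagged _ k.

Lemma vertex_inj i : injective (@vertex i).
Proof. by move=> k k' /eqP; rewrite eq_Tagged => /eqP. Qed.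

Lemma partE i : V i = @vertex i @: setT.
Proof.
apply/setP=> -[j k]; rewrite inE /=; apply/eqP/imsetP=> [eij|[k' _ /(congr1 (@tag _ _))//]].
by subst; exists k.
Qed.

Lemma card_part i : #|V i| = N i.
Proof. by rewrite partE card_imset ?cardsT ?card_ord //; apply: vertex_inj. Qed.

Lemma edge_tripartite (x y : tri_vertex a b c) :
  ([set x; y] \in complete_tripartite a b c) = (tag x != tag y).
Proof.
apply/bigcupP/idP => [[[i j] /= ltij /crossP[x' [y' []]]]|neq].
  rewrite !in_part => /eqP tx /eqP ty eqe; apply/eqP => txy.
  have tagE z : z \in [set x'; y'] -> tag z = tag x.
    by rewrite -eqe !inE => /orP[]/eqP->.
  by rewrite -tx -ty (tagE x' (set21 _ _)) (tagE y' (set22 _ _)) ltnn in ltij.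
have [lt|gt|/val_inj eq] := ltngtP (tag x) (tag y); last by rewrite eq eqxx in neq.
  by exists (tag x, tag y) => //; rewrite in_cross ?in_part.
by exists (tag y, tag x) => //; rewrite setUC in_cross ?in_part.
Qed.

Lemma tripartite_edgeP e : e \in complete_tripartite a b c ->
  exists x y : tri_vertex a b c, e = [set x; y] /\ tag x < tag y.
Proof.
case/bigcupP => -[i j] /= ltij /crossP[x [y [Vx Vy ->]]]; exists x, y.
by move: Vx Vy; rewrite !in_part => /eqP-> /eqP->.
Qed.

Lemma card_tripartite_le (G : {set {set tri_vertex a b c}}) :
  let B i j := G :&: cross (V i) (V j) in
  let i0 := @Ordinal 3 0 isT in let i1 := @Ordinal 3 1 isT in
  let i2 := @Ordinal 3 2 isT in
  G \subset complete_tripartite a b c -> #|G| <= #|B i0 i1| + #|B i0 i2| + #|B i1 i2|.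
Proof.
move=> B i0 i1 i2 sGH.
suff sG : G \subset B i0 i1 :|: B i0 i2 :|: B i1 i2.
  apply: leq_trans (subset_leq_card sG) (leq_trans (leq_card_setU _ _) _).
  by rewrite leq_add2r leq_card_setU.
apply/subsetP=> e Ge; have /tripartite_edgeP[x [y [De ltxy]]] := subsetP sGH e Ge.
have : e \in B (tag x) (tag y) by rewrite inE Ge De in_cross ?in_part.
suff /or3P[] : [|| (tag x == i0) && (tag y == i1), (tag x == i0) && (tag y == i2)
                  | (tag x == i1) && (tag y == i2)].
- by case/andP=> /eqP-> /eqP-> Be; rewrite !in_setU Be.
- by case/andP=> /eqP-> /eqP-> Be; rewrite !in_setU Be orbT.
- by case/andP=> /eqP-> /eqP-> Be; rewrite !in_setU Be !orbT.
by case: (tag x) (tag y) ltxy => [[|[|[|//]]] ?] [[|[|[|//]]] ?].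
Qed.

End TripartiteVertices.

(** Replaces the injection of vertices by the three images of the parts; the
    converse enumerates each set.  Distinctness of x and y must be requested
    because [set x; x] is a singleton, which a general G may contain. *)
Lemma has_tripartite_copyP (T : finType) (G : {set {set T}}) a b c :
  reflect (exists X : 'I_3 -> {set T},
      (forall i, #|X i| = part_size a b c i) /\
      forall (i j : 'I_3) x y, i < j -> x \in X i -> y \in X j -> x != y /\ [set x; y] \in G)
    (has_copy (complete_tripartite a b c) G).
Proof.
apply: (iffP existsP) => [[f /andP[/injectiveP injf /forall_inP Gf]]|[X [cardX GX]]].
  exists (fun i => f @: part a b c i); split=> [i|i j u v ltij].
    by rewrite card_imset // card_part.
  case/imsetP=> x; rewrite in_part => /eqP tx ->.
  case/imsetP=> y; rewrite in_part => /eqP ty ->.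
  have neq : tag x != tag y by rewrite tx ty -val_eqE neq_ltn ltij.
  rewrite (inj_eq injf) (contra_neq _ neq) => [|->//]; split=> //.
  by have := Gf [set x; y]; rewrite edge_tripartite imsetU1 imset_set1; apply.
pose g (v : tri_vertex a b c) : T :=
  enum_val (cast_ord (esym (cardX (tag v))) (tagged v)).
have Xg v : g v \in X (tag v) by apply: enum_valP.
have gP (u v : tri_vertex a b c) : tag u < tag v -> g u != g v /\ [set g u; g v] \in G.
  by move=> ltuv; apply: (GX _ _ _ _ ltuv).
have injg : injective g.
  move=> u v; have [/gP[/eqP]//|/gP[/eqP nvu _] /esym//|] := ltngtP (tag u) (tag v).
  case: u v => i k [j k'] /= /val_inj eij; subst j; rewrite /g /=.
  by move/enum_val_inj/cast_ord_inj->.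
exists (finfun g); apply/andP; split.
  by apply/injectiveP => u v; rewrite !ffunE => /injg.
apply/forall_inP => e /tripartite_edgeP[x [y [-> ltxy]]].
by rewrite imsetU1 imset_set1 !ffunE; case: (gP x y ltxy).
Qed.

(** * Saturation and size of the construction *)

Section Construction.
Variables (l m n1 n2 n3 : nat) (G : {set {set tri_vertex n1 n2 n3}}).
Hypotheses (m_gt0 : 0 < m) (le_ml : m <= l).
Hypothesis le_ln : forall i, l <= part_size n1 n2 n3 i.
Local Notation V := (part n1 n2 n3).
Local Notation N := (part_size n1 n2 n3).
Local Notation H := (complete_tripartite n1 n2 n3).

Hypothesis sGH : G \subset H.
Variable S : 'I_3 -> {set tri_vertex n1 n2 n3}.
Hypothesis SV : forall i, S i \subset V i.
Hypothesis cardS : forall i, #|S i| = m - 1.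
Hypothesis S_full : forall i, cross (S i) (V (ordS i) :|: V (ordS (ordS i))) \subset G.
Hypothesis bip : forall i j : 'I_3, i < j ->
  let B := G :&: cross (V i :\: S i) (V j :\: S j) in
  #|B| = (l - m) * (N j - m + 1) /\ max_degree B <= l - m.

(** The two successors of i modulo 3 are the two indices other than i. *)
Lemma dominating i j x y : i != j -> x \in S i -> y \in V j -> [set x; y] \in G.
Proof.
move=> nij Sx Vy; apply: (subsetP (S_full i)); apply: in_cross => //.
have : (j == ordS i) || (j == ordS (ordS i)).
  by case: i j nij {Sx Vy} => [[|[|[|//]]] ?] [[|[|[|//]]] ?].
by rewrite inE => /orP[]/eqP<-; rewrite Vy ?orbT.
Qed.

Lemma disjoint_rest i j : i != j -> [disjoint V i :\: S i & V j :\: S j].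
Proof.
move=> nij; apply: disjointWl (subsetDl _ _) _; apply: disjointWr (subsetDl _ _) _.
exact: part_disjoint.
Qed.

Lemma card_rest i : #|V i :\: S i| = N i - m + 1.
Proof.
rewrite cardsD (setIidPr (SV i)) card_part cardS.
by have := le_ln i; lia.
Qed.

(** The degree bound is symmetric in the two sides, hence the unordered pair
    of indices, in contrast with nbrs_rest_eq. *)
Lemma nbrs_rest_le i j y : i != j -> y \in V j :\: S j ->
  #|nbrs G y (V i :\: S i)| <= l - m.
Proof.
move=> nij By; rewrite -(degree_bipartite G (disjoint_rest nij) By).
suff /max_degreeP : max_degree (G :&: cross (V i :\: S i) (V j :\: S j)) <= l - m by [].
have [lt|gt|/val_inj eij] := ltngtP i j; last by rewrite eij eqxx in nij.
  by case: (bip lt).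
by rewrite cross_sym; case: (bip gt).
Qed.

Lemma nbrs_rest_eq (i j : 'I_3) y : i < j -> y \in V j :\: S j ->
  #|nbrs G y (V i :\: S i)| = l - m.
Proof.
move=> ltij; have nij : i != j by rewrite -val_eqE neq_ltn ltij.
have [cardB degB] := bip ltij.
by apply: (bipartite_degree_eq (disjoint_rest nij)) => //; rewrite card_rest.
Qed.

(** The parts of a copy are matched with the parts V_i, and then a vertex y of
    the second part of the copy outside S has too many neighbours. *)
Lemma tripartite_free p : 0 < p -> ~~ has_copy (complete_tripartite l m p) G.
Proof.
move=> p_gt0; apply/has_tripartite_copyP => -[X [cardX GX]].
have tag_neq i j u v : i != j -> u \in X i -> v \in X j -> tag u != tag v.
  move=> nij Xu Xv; have [lt|gt|/val_inj eij] := ltngtP i j; last by rewrite eij eqxx in nij.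
    by have [_ /(subsetP sGH)] := GX _ _ _ _ lt Xu Xv; rewrite edge_tripartite.
  by have [_ /(subsetP sGH)] := GX _ _ _ _ gt Xv Xu; rewrite edge_tripartite eq_sym.
have X_n0 i : {x | x \in X i}.
  apply/sigW/set0Pn; rewrite -card_gt0 cardX.
  by case: i => [[|[|[|//]]] ?] //=; exact: leq_trans le_ml.
(* g i is the part of the host containing one chosen vertex of X i; it is
   injective on three indices, hence onto, which leaves X i no other part. *)
pose g i := tag (sval (X_n0 i)).
have injg : injective g.
  move=> i j; apply: contra_eq => nij.
  exact: tag_neq nij (svalP (X_n0 i)) (svalP (X_n0 j)).
have XV i : X i \subset V (g i).
  apply/subsetP => u Xu; rewrite in_part.
  have [g' _ gK] := injF_bij injg; rewrite -(gK (tag u)).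
  apply/eqP; congr g; apply/eqP; apply: contraT => ne.
  by have := tag_neq _ _ _ _ ne (svalP (X_n0 _)) Xu; rewrite -/(g _) gK eqxx.
pose i0 : 'I_3 := @Ordinal 3 0 isT; pose i1 : 'I_3 := @Ordinal 3 1 isT.
have [cardX0 cardX1] : #|X i0| = l /\ #|X i1| = m by rewrite !cardX.
have [y Xy nSy] : exists2 y, y \in X i1 & y \notin S (g i1).
  apply/subsetPn/negP => /subset_leq_card.
  by rewrite cardX1 cardS; lia.
have /nbrs_rest_le le : g i0 != g i1 by rewrite (inj_eq injg).
have {le} := le y; rewrite inE nSy (subsetP (XV i1)) // => /(_ isT).
(* At least l - (m - 1) vertices of X i0 escape S, one more than l - m. *)
have sX : X i0 :\: S (g i0) \subset nbrs G y (V (g i0) :\: S (g i0)).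
  apply/subsetP => x /setDP[Xx nSx]; rewrite !inE nSx -in_part (subsetP (XV i0)) //.
  by case: (GX i0 i1 x y).
have := subset_leq_card sX; rewrite cardsD cardX0.
have : #|X i0 :&: S (g i0)| <= m - 1 by rewrite -(cardS (g i0)) subset_leq_card ?subsetIr.
by lia.
Qed.

(** The copy consists of S_i, x and the l - m neighbours of y outside S_i in
    V_i; of S_j and y in V_j; and of p vertices of S_k.  Only the pair xy is not
    already an edge: the others meet S or join y to one of its neighbours. *)
Lemma tripartite_saturating p e : p < m -> e \in H :\: G ->
  has_copy (complete_tripartite l m p) (e |: G).
Proof.
move=> ltpm /setDP[/tripartite_edgeP[x [y [-> ltxy]]] nGe].
set i := tag x in ltxy; set j := tag y in ltxy.
have nij : i != j by rewrite -val_eqE neq_ltn ltxy.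
have Vx : x \in V i by rewrite in_part.
have Vy : y \in V j by rewrite in_part.
have nSx : x \notin S i by apply: contra nGe => Sx; apply: dominating nij Sx Vy.
have nSy : y \notin S j.
  apply: contra nGe => Sy; rewrite setUC; apply: dominating Sy Vx; by rewrite eq_sym.
have [k nik njk] : exists2 k, i != k & j != k.
  case: (i) (j) => [[|[|[|//]]] ?] [[|[|[|//]]] ?];
    by [exists (@Ordinal 3 0 isT)|exists (@Ordinal 3 1 isT)|exists (@Ordinal 3 2 isT)].
have [P sPS cardP] : exists2 P : {set _}, P \subset S k & #|P| = p.
  have /card_geqP[s [us sz sS]] : p <= #|S k| by rewrite cardS subn1 -ltnS prednK.
  exists [set v in s]; first by apply/subsetP=> v; rewrite inE => /sS.
  by rewrite cardsE (card_uniqP us).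
pose W := nbrs G y (V i :\: S i).
have nWx : x \notin W by rewrite inE (negPf nGe) andbF.
have sAV : S i :|: (x |: W) \subset V i.
  rewrite !subUset SV sub1set Vx /=.
  by apply/subsetP => z; rewrite inE => /andP[/setDP[]].
have sBV : y |: S j \subset V j by rewrite subUset sub1set Vy SV.
have AB_edge u v : u \in S i :|: (x |: W) -> v \in y |: S j ->
    [set u; v] \in [set x; y] |: G.
  move=> Au; rewrite in_setU1 => /orP[/eqP-> {v}|Sv]; last first.
    apply: setU1r; rewrite setUC; apply: dominating Sv (subsetP sAV _ Au).
    by rewrite eq_sym.
  move: Au; rewrite in_setU in_setU1 => /or3P[Su|/eqP->|]; last 1 first.
  - by rewrite inE => /andP[_]; apply: setU1r.
  - by apply: setU1r; apply: dominating nij Su Vy.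
  - exact: setU11.
have P_edge i' u v : i' != k -> u \in V i' -> v \in P ->
    u != v /\ [set u; v] \in [set x; y] |: G.
  move=> nik' Vu Pv; have Sv := subsetP sPS _ Pv; split.
    apply: contraTneq Vu => ->; have := subsetP (SV k) _ Sv.
    by rewrite !in_part => /eqP->; rewrite eq_sym.
  by apply: setU1r; rewrite setUC; apply: dominating Sv Vu; rewrite eq_sym.
apply/has_tripartite_copyP.
exists (fun t : 'I_3 => nth set0 [:: S i :|: (x |: W); y |: S j; P] t); split.
  move=> [[|[|[|//]]] ?] /=; last exact: cardP; last first.
    by rewrite cardsU1 nSy cardS add1n subn1 prednK.
  rewrite cardsU (_ : _ :&: _ = set0) ?cards0; last first.
    apply/setP=> z; rewrite !inE; apply/andP => -[Sz].
    by rewrite Sz /= orbF => /eqP ezx; rewrite ezx (negPf nSx) in Sz.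
  rewrite cardsU1 nWx cardS /W (nbrs_rest_eq ltxy) ?inE ?nSy ?eqxx //.
  by rewrite subn0 subn1 addnA addn1 prednK // subnKC.
move=> [[|[|[|//]]] ?] [[|[|[|//]]] ?] //= u v _ Xu Xv.
- split; last exact: AB_edge.
  apply: contraNneq nij => euv; have := subsetP sBV _ Xv; have := subsetP sAV _ Xu.
  by rewrite euv !in_part => /eqP <- /eqP ->.
- exact: P_edge nik (subsetP sAV _ Xu) Xv.
- exact: P_edge njk (subsetP sBV _ Xu) Xv.
Qed.

Lemma construction_saturated p : 0 < p -> p < m ->
  saturated H (complete_tripartite l m p) G.
Proof.
move=> p_gt0 ltpm; rewrite /saturated sGH tripartite_free //=.
by apply/forall_inP => e; apply: tripartite_saturating.
Qed.

(** The only pairs that may be missing are those avoiding S.  Stated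
    additively to keep truncated subtraction out. *)
Lemma card_between (i j : 'I_3) : i < j ->
  #|G :&: cross (V i) (V j)| + (N i - m + 1) * (N j - m + 1)
    = N i * N j + (l - m) * (N j - m + 1).
Proof.
move=> ltij; have nij : i != j by rewrite -val_eqE neq_ltn ltij.
set C := cross (V i) (V j); set R := cross (V i :\: S i) (V j :\: S j).
have sRC : R \subset C by apply: crossS; apply: subsetDl.
have cardC : #|C| = N i * N j by rewrite card_cross ?part_disjoint // !card_part.
have cardR : #|R| = (N i - m + 1) * (N j - m + 1).
  by rewrite card_cross ?disjoint_rest // !card_rest.
have [cardGR _] := bip ltij; rewrite -/R in cardGR.
(* All pairs of C that meet S are edges of G. *)
have GCR : G :&: C :\: R = C :\: R.
  apply/setP=> e; rewrite !inE; case: (boolP (e \in R)) => //= nRe.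
  apply: andb_idl => /crossP[x [y [Vx Vy De]]]; rewrite De.
  have [Sx|nSx] := boolP (x \in S i); first exact: dominating nij Sx Vy.
  have [Sy|nSy] := boolP (y \in S j); first by rewrite setUC (dominating _ Sy Vx) // eq_sym.
  by rewrite De in_cross // inE ?nSx ?nSy in nRe.
have := cardsID R (G :&: C); have := cardsID R C.
by rewrite GCR -setIA (setIidPr sRC) cardGR cardC cardR; clear; lia.
Qed.

Lemma construction_card :
  (#|G|%:Z <= 2 * (m%:Z - 1) * (n1%:Z + n2%:Z + n3%:Z)
     + (l%:Z - m%:Z) * (n2%:Z + 2 * n3%:Z)
     - 3 * l%:Z * (m%:Z - 1) + 3 * m%:Z - 3)%R.
Proof.
pose i0 := @Ordinal 3 0 isT; pose i1 := @Ordinal 3 1 isT; pose i2 := @Ordinal 3 2 isT.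
have := card_tripartite_le sGH; rewrite /= -/i0 -/i1 -/i2.
have := @card_between i0 i1 isT; have := @card_between i0 i2 isT.
have := @card_between i1 i2 isT.
have le_mN i : m <= N i by apply: leq_trans (le_ln i).
(* Writing every size as m plus a natural number makes the truncated
   differences disappear, so that only a polynomial inequality remains. *)
have [a1 E1] : exists a, n1 = m + a by exists (n1 - m); rewrite (subnKC (le_mN i0)).
have [a2 E2] : exists a, n2 = m + a by exists (n2 - m); rewrite (subnKC (le_mN i1)).
have [a3 E3] : exists a, n3 = m + a by exists (n3 - m); rewrite (subnKC (le_mN i2)).
have [d El] : exists d, l = m + d by exists (l - m); rewrite subnKC.
have [-> -> ->] : [/\ N i0 = m + a1, N i1 = m + a2 & N i2 = m + a3] by [].
move: #|_| #|_| #|_| #|_| => e12 e02 e01 e.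
rewrite E1 E2 E3 El !addKn; clear.
by move=> H12 H02 H01 le_e; lia.
Qed.

End Construction.

(** * Existence: a circulant graph between the remaining vertices *)

Lemma card_ord_lt n d : d <= n -> #|[set k : 'I_n | k < d]| = d.
Proof.
move=> le_dn; have inj_w : injective (widen_ord le_dn) by move=> k k' /(congr1 val)/= /val_inj.
rewrite -[RHS]card_ord -cardsT -(card_imset _ inj_w).
apply: eq_card => k; rewrite inE; apply/idP/imsetP => [lt|[k' _ ->] /=]; last by [].
by exists (Ordinal lt) => //; apply: val_inj.
Qed.

Section Circulant.
Variables (n1 n2 n3 d m : nat).
Local Notation T := (tri_vertex n1 n2 n3).
Local Notation V := (part n1 n2 n3).
Local Notation N := (part_size n1 n2 n3).
Local Notation H := (complete_tripartite n1 n2 n3).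
Hypothesis m_gt0 : 0 < m.
Hypothesis le_mN : forall i, m + d <= N i.
Hypothesis N_anti : forall i j : 'I_3, i < j -> N j <= N i.

(** The m - 1 vertices of largest index in their part, so that the others are
    numbered 0, ..., N i - m and serve as residues directly. *)
Definition apex i : {set T} := [set v in V i | N i - m < tagged v].

(** A residue modulo M + 1: inZp reduces into the additive group 'I_M.+1. *)
Definition shift M (x y : T) : 'I_M.+1 := (inZp (tagged x) - inZp (tagged y))%R.

Definition circulant_adj (x y : T) : bool :=
  (tag x < tag y) &&
  [|| x \in apex (tag x), y \in apex (tag y) | shift (N (tag x) - m) x y < d].

Definition circulant_graph : {set {set T}} :=
  [set [set xy.1; xy.2] | xy : T * T & circulant_adj xy.1 xy.2].

Lemma circulant_edge (x y : T) : tag x < tag y ->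
  ([set x; y] \in circulant_graph) = circulant_adj x y.
Proof.
move=> ltxy; apply/imsetP/idP => [[[x' y']]|adj]; last by exists (x, y); rewrite ?inE.
rewrite inE /= => adj eqe; have /andP[lt' _] := adj.
suff [-> ->] : x = x' /\ y = y' by [].
have := set21 x' y'; have := set22 x' y'; rewrite -eqe !inE.
case/orP=> /eqP ey /orP[]/eqP ex; rewrite ex ey ?ltnn // in lt' *.
by have := ltn_trans lt' ltxy; rewrite ltnn.
Qed.

Lemma circulant_sub : circulant_graph \subset H.
Proof.
apply/subsetP => e /imsetP[[x y]]; rewrite inE => /andP[/= lt _] ->.
by rewrite edge_tripartite -val_eqE neq_ltn lt.
Qed.

Lemma apex_sub i : apex i \subset V i.
Proof. by apply/subsetP=> v; rewrite inE => /andP[]. Qed.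

Lemma in_rest i (k : 'I_(N i)) :
  (vertex k \in V i :\: apex i) = (k < (N i - m).+1).
Proof. by rewrite !inE /= eqxx andbT ltnS -leqNgt. Qed.

Lemma restE i :
  V i :\: apex i = @vertex n1 n2 n3 i @: [set k : 'I_(N i) | k < (N i - m).+1].
Proof.
apply/setP=> v; apply/idP/imsetP => [|[k]]; last by rewrite inE -in_rest => Rk ->.
case: v => j k Rv; have /eqP /= ij : j == i by move: Rv; rewrite !inE => /andP[].
by subst j; exists k; rewrite // inE -in_rest.
Qed.

Lemma card_circulant_rest i : #|V i :\: apex i| = (N i - m).+1.
Proof.
rewrite restE card_imset; last exact: vertex_inj.
by rewrite card_ord_lt //; have := le_mN i; lia.
Qed.

Lemma card_apex i : #|apex i| = m - 1.
Proof.
have := card_circulant_rest i; rewrite cardsD (setIidPr (apex_sub i)) card_part.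
by have := subset_leq_card (apex_sub i); rewrite card_part; have := le_mN i; lia.
Qed.

(** M may exceed N i - m: for i < j the residues are taken modulo the size of
    the larger side R_i, into which R_j must embed too. *)
Lemma inZp_rest_inj M i : N i - m <= M ->
  {in V i :\: apex i &, injective (fun v : T => inZp (tagged v) : 'I_M.+1)}.
Proof.
move=> leM u v; rewrite restE => /imsetP[k /[!inE] ltk ->] /imsetP[k' /[!inE] ltk' ->].
move=> /(congr1 val) /=; rewrite !modn_small; try exact: leq_trans leM.
by move/val_inj->.
Qed.

Lemma circulant_edge_rest (i j : 'I_3) x y : i < j ->
    x \in V i :\: apex i -> y \in V j :\: apex j ->
  ([set x; y] \in circulant_graph) = (shift (N i - m) x y < d).
Proof.
move=> ltij /setDP[]; rewrite in_part => /eqP tx; subst i => nx.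
move=> /setDP[]; rewrite in_part => /eqP ty; subst j => ny.
by rewrite circulant_edge // /circulant_adj ltij (negPf nx) (negPf ny).
Qed.

(** For fixed y, x |-> x - y is a bijection from R_i onto the residues modulo
    |R_i|, so each of the d small residues is hit exactly once. *)
Lemma circulant_nbrs_left (i j : 'I_3) y : i < j -> y \in V j :\: apex j ->
  #|nbrs circulant_graph y (V i :\: apex i)| = d.
Proof.
move=> ltij Ry; pose f x := shift (N i - m) x y.
have injf : {in V i :\: apex i &, injective f}.
  by move=> u v Ru Rv /GRing.addIr; apply: inZp_rest_inj.
have fR : f @: (V i :\: apex i) = setT.
  by apply/eqP; rewrite eqEcard subsetT card_in_imset // card_circulant_rest cardsT card_ord /=.
have le_d : d <= (N i - m).+1 by have := le_mN i; lia.
rewrite -[RHS](card_ord_lt le_d) -(card_in_imset (f := f)); last first.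
  by apply: sub_in2 injf => u; rewrite in_nbrs => /andP[].
apply: eq_card => k; rewrite in_set; apply/imsetP/idP => [[x]|ltk].
  rewrite in_nbrs => /andP[Rx].
  by rewrite (circulant_edge_rest ltij) // => ? ->.
have : k \in f @: (V i :\: apex i) by rewrite fR.
case/imsetP=> x Rx ek; exists x => //.
by rewrite in_nbrs Rx (circulant_edge_rest ltij) // -/(f x) -ek.
Qed.

(** For fixed x, y |-> x - y is injective on R_j; it need not be onto, since R_j
    may be smaller than R_i, hence only a bound. *)
Lemma circulant_nbrs_right (i j : 'I_3) x : i < j -> x \in V i :\: apex i ->
  #|nbrs circulant_graph x (V j :\: apex j)| <= d.
Proof.
move=> ltij Rx; pose f y := shift (N i - m) x y.
have le_d : d <= (N i - m).+1 by have := le_mN i; lia.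
rewrite -[X in _ <= X](card_ord_lt le_d) -(card_in_imset (f := f)); last first.
  move=> u v /[!in_nbrs] /andP[Ru _] /andP[Rv _] /GRing.addrI /GRing.oppr_inj.
  exact: (inZp_rest_inj (leq_sub2r m (N_anti ltij))) Ru Rv.
apply/subset_leq_card/subsetP => k /imsetP[y /[!in_nbrs] /andP[Ry Gxy] ->].
by rewrite in_set -(circulant_edge_rest ltij) // setUC.
Qed.

Lemma circulant_apex i y x : x \in apex i -> y \notin V i ->
  [set x; y] \in circulant_graph.
Proof.
move=> Sx; have := subsetP (apex_sub i) _ Sx; rewrite !in_part => /eqP tx; subst i => ne.
have [lt|gt|/val_inj eij] := ltngtP (tag x) (tag y); last by rewrite eij eqxx in ne.
  by rewrite circulant_edge // /circulant_adj lt Sx.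
by rewrite setUC circulant_edge // /circulant_adj gt Sx orbT.
Qed.

Lemma circulant_C3 : C3 (m + d) m circulant_graph.
Proof.
split; first exact: circulant_sub.
exists apex; split=> [i|i|i j ltij B].
- by rewrite apex_sub card_apex.
- apply/subsetP => e /crossP[x [y [Sx Vy ->]]]; apply: circulant_apex Sx _.
  by move: Vy; rewrite !inE; case: i {x} => [[|[|[|//]]] ?] /orP[]/eqP->.
have dR : [disjoint V i :\: apex i & V j :\: apex j].
  apply: disjointWl (subsetDl _ _) _; apply: disjointWr (subsetDl _ _) _.
  by rewrite part_disjoint // -val_eqE neq_ltn ltij.
rewrite addKn /B; split; last first.
  apply: max_degree_bipartite => // v Rv; first by rewrite (circulant_nbrs_left ltij).
  exact: circulant_nbrs_right Rv.
rewrite card_bipartite //.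
under eq_bigr => y Ry do rewrite (circulant_nbrs_left ltij) //.
by rewrite sum_nat_const card_circulant_rest mulnC addn1.
Qed.
End Circulant.

Theorem theorem2 (l m p n1 n2 n3 : nat) :
  0 < l -> 0 < m -> 0 < p -> m <= l -> p < m ->
  n2 <= n1 -> n3 <= n2 -> l <= n3 ->
  (forall G : {set {set tri_vertex n1 n2 n3}},
     C3 l m G ->
     saturated (complete_tripartite n1 n2 n3) (complete_tripartite l m p) G) /\
  ((sat (complete_tripartite n1 n2 n3) (complete_tripartite l m p))%:Z <=
     2 * (m%:Z - 1) * (n1%:Z + n2%:Z + n3%:Z)
     + (l%:Z - m%:Z) * (n2%:Z + 2 * n3%:Z)
     - 3 * l%:Z * (m%:Z - 1) + 3 * m%:Z - 3)%R.
Proof.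
move=> l_gt0 m_gt0 p_gt0 le_ml lt_pm le21 le32 le_ln.
have le_lN i : l <= part_size n1 n2 n3 i.
  by case: i => [[|[|[|//]]] ?]; rewrite /part_size /=; lia.
have satG (G : {set {set tri_vertex n1 n2 n3}}) : C3 l m G ->
    saturated (complete_tripartite n1 n2 n3) (complete_tripartite l m p) G.
  case=> sGH [S [SP Sfull bip]].
  exact: (construction_saturated m_gt0 le_ml le_lN sGH (fun i => (SP i).1)
            (fun i => (SP i).2) Sfull bip p_gt0 lt_pm).
have cardG (G : {set {set tri_vertex n1 n2 n3}}) : C3 l m G ->
    (#|G|%:Z <= 2 * (m%:Z - 1) * (n1%:Z + n2%:Z + n3%:Z)
     + (l%:Z - m%:Z) * (n2%:Z + 2 * n3%:Z)
     - 3 * l%:Z * (m%:Z - 1) + 3 * m%:Z - 3)%R.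
  case=> sGH [S [SP Sfull bip]].
  exact: (construction_card m_gt0 le_ml le_lN sGH (fun i => (SP i).1)
            (fun i => (SP i).2) Sfull bip).
split=> //.
have N_anti (i j : 'I_3) : i < j -> part_size n1 n2 n3 j <= part_size n1 n2 n3 i.
  by case: i j => [[|[|[|//]]] ?] [[|[|[|//]]] ?] //= _; rewrite /part_size //= (leq_trans le32).
have GC3 : C3 l m (circulant_graph n1 n2 n3 (l - m) m).
  rewrite -{1}(subnKC le_ml); apply: circulant_C3 => // i.
  by rewrite subnKC.
move: (circulant_graph _ _ _ _ _) GC3 => G GC3.
apply: Order.POrderTheory.le_trans (cardG _ GC3).
by rewrite lez_nat; apply: sat_le (satG _ GC3).
Qed.
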